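(* Let $R_N$ be an $N\times N$ random matrix with i.i.d. Gaussian entries, each of mean zero and variance one. Let $b=b(N)\ge\log N$ be a sequence of (positive) integers, and let $\gamma>5/2$ be a constant. Then, with probability tending to $1$ as $N\to\infty$, we have $$\rho\bigl(T_{b,N}+\exp(-\gamma b)R_N\bigr)\le\exp\left(-\gamma+\frac{2\log N}{b}\right)+o(1),$$ where $\rho$ denotes the spectral radius and $o(1)$ denotes a small quantity tending to zero as $N\to\infty$. In particular, the bound on the spectral radius is strictly less than $\exp(-1/2)<1$ in the limit as $N\to\infty$.
   Context: The spectral radius of a matrix is the maximum absolute value of its eigenvalues. For a positive integer $b$, $T_{b,N}$ is the $N\times N$ block diagonal matrix in which each $(b+1)\times(b+1)$ diagonal block equals $T_{b+1}$, where $T_{m}$ is the $m\times m$ nilpotent matrix with ones at entries $(i,i+1)$, $1\le i\le m-1$, and zeros elsewhere; if $b+1$ does not divide $N$, a block of zeros is inserted at the bottom of the diagonal. Thus all entries of $T_{b,N}$ are zero except on the superdiagonal (entries $(i,i+1)$, $1\le i\le N-1$), which equals $(\underbrace{1,\dots,1}_{b},0,\underbrace{1,\dots,1}_{b},0,\dots,\underbrace{1,\dots,1}_{b},\underbrace{0,\dots,0}_{\le b})$; there are $\lfloor N/(b+1)\rfloor$ nonzero blocks. *)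

(* Defs.v *)
From HB Require Import structures.
From mathcomp Require Import all_boot all_order all_algebra.
From mathcomp Require Export complex.
From mathcomp Require Import all_classical all_reals all_analysis.
Set Implicit Arguments.
Unset Strict Implicit.
Unset Printing Implicit Defensive.
Import Order.TTheory GRing.Theory Num.Theory.
Import numFieldNormedType.Exports.
Local Open Scope classical_set_scope.
Local Open Scope ring_scope.

(* The spectrum of a matrix of positive size is finite and nonempty, so this
   supremum is a maximum. *)
Definition spectral_radius (R : realType) (N : nat) (A : 'M[R[i]]_N) : R :=
  sup [set Normc.normc z | z in [set z : R[i] | eigenvalue A z]].

Definition nilpotent_block (F : pzRingType) (m : nat) : 'M[F]_m :=
  \matrix_(i < m, j < m) ((j : nat) == i.+1)%:R.

(* Row i lies in diagonal block number i %/ b.+1, at position i %% b.+1. Only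
   the first N %/ b.+1 blocks are complete; the rest of the matrix is zero. *)
Definition nilpotent_blocks (F : pzRingType) (b N : nat) : 'M[F]_N :=
  \matrix_(i < N, j < N)
    (if (i %/ b.+1 == j %/ b.+1)%N && (i %/ b.+1 < N %/ b.+1)%N
     then nilpotent_block F b.+1 (inord (i %% b.+1)) (inord (j %% b.+1))
     else 0).

Lemma nilpotent_blocksE (F : pzRingType) (b N : nat) (i j : 'I_N) :
  nilpotent_blocks F b N i j = [&& (j : nat) == i.+1, (i %% b.+1 != b)%N
                   & (i %/ b.+1 < N %/ b.+1)%N]%:R.
Proof.
rewrite !mxE; case: (ltnP (i %/ b.+1) (N %/ b.+1)) => _; last first.
  by rewrite !andbF.
rewrite !andbT !inordK ?ltn_pmod//.
have ei := divn_eq i b.+1; have ej := divn_eq j b.+1.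
have [eq|neq] := eqVneq (i %/ b.+1)%N (j %/ b.+1)%N.
  have -> : ((j : nat) == i.+1) = ((j %% b.+1) == (i %% b.+1).+1)%N.
    by rewrite [in LHS]ej [in LHS]ei -eq -addnS eqn_add2l.
  congr (_%:R); congr nat_of_bool.
  case: eqVneq => //= h; apply/esym/eqP => h2.
  by move: (ltn_pmod j (ltn0Sn b)); rewrite h h2 ltnn.
case: eqVneq => //= eji; case: eqVneq => //= nb; case/eqP: neq.
have lt : ((i %% b.+1).+1 < b.+1)%N.
  by rewrite ltn_neqAle eqSS nb ltn_pmod.
by rewrite eji [in RHS]ei -addnS divnMDl// (divn_small lt) addn0.
Qed.

(* R[i] carries no sigma-algebra in the library: a complex random variable is
   observed through its real and imaginary parts. *)
Definition reim (R : realType) (z : R[i]) : R * R :=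
  (complex.Re z, complex.Im z).

Variant gaussian_kind := RealGaussian | ComplexGaussian.

(* The Gaussian law on C = R * R with mean 0 and variance E|z|^2 = 1, either
   real or circularly symmetric complex. The second parameter of normal_prob
   is the standard deviation. *)
Definition std_gaussian (R : realType) (k : gaussian_kind) :
    set (R * R) -> \bar R :=
  match k with
  | RealGaussian => (normal_prob (0 : R)%R 1%R \x \d_(0 : R)%R)%E
  | ComplexGaussian =>
      let s : R := Num.sqrt 2^-1 in
      (normal_prob 0%R s \x normal_prob 0%R s)%E
  end.

Section random_matrices.
Context (R : realType) (d : measure_display) (T : measurableType d).
Variable P : probability T R.

Definition mutually_independent (I : finType) (X : I -> T -> R[i]) : Prop :=
  forall (J : {set I}) (B : I -> set (R * R)),
    (forall i, measurable (B i)) ->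
    P (\bigcap_(i in [set` J]) ((@reim R \o X i) @^-1` B i)) =
    (\prod_(i in J) P ((@reim R \o X i) @^-1` B i))%E.

Definition iid_gaussian_mx (k : gaussian_kind) (N : nat)
    (G : T -> 'M[R[i]]_N) : Prop :=
  [/\ forall i j, measurable_fun [set: T] (fun w => reim (G w i j)),
      forall i j (B : set (R * R)), measurable B ->
        P ((fun w => reim (G w i j)) @^-1` B) = std_gaussian k B
    & mutually_independent (fun (ij : 'I_N * 'I_N) w => G w ij.1 ij.2)].

End random_matrices.

(* Main.v *)
Require Import Defs.
From HB Require Import structures.
From mathcomp Require Import all_boot all_order all_algebra.
From mathcomp Require Import complex.
From mathcomp Require Import all_classical all_reals all_analysis.
From mathcomp Require Import measurable_realfun ring lra.
Import Order.TTheory GRing.Theory Num.Theory.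
Import numFieldNormedType.Exports.
Local Open Scope classical_set_scope.
Local Open Scope ring_scope.

(** Why the theorem holds.  Write rho for the spectral radius, T for the block
    nilpotent matrix, whose power b+1 vanishes, and delta = exp(-gamma b).  Let
    z be an eigenvalue of T + delta G with row eigenvector v, and r = |z|.
    Since z v differs from v T only by delta (v G), iterating b+1 times until
    the power of T disappears expresses z^(b+1) v through the perturbation
    alone.  In the l1 norm, which T does not increase, this gives
      r^(b+1) <= delta K (1 + r + ... + r^b),
    where K bounds the absolute row sums of G (eigenvalue_pow_le).  When
    delta K (b+1) <= 1 this forces r^(b+1) <= delta K (b+1)
    (pow_le_geometric).  If all entries of G are at most N in modulus then
    K = N^2 is allowed, so that
      r <= exp((- gamma b + 2 log N + log (b+1)) / (b+1)).
    The exponent exceeds - gamma + 2 log N / b by at most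
    (gamma + log (b+1)) / (b+1), which tends to 0 because b >= log N does tend
    to infinity.  This is the deterministic part, spectral_radius_shift_le; the
    assumption gamma > 5/2 enters through delta N^2 (b+1) <= 1, as
    N^2 <= exp(2 b).

    The probabilistic part is elementary: a Gaussian entry exceeds N with
    probability exponentially small in N^2, so a union bound over the N^2
    entries is enough (gaussian_entries_le, union_bound_le).  The exponent 2 in
    the statement leaves room for the crude row sum bound K = N^2.

    A measure is only controlled on measurable sets, so the event
    rho(T + delta G) <= c has itself to be shown measurable.  By the
    factorization of the characteristic polynomial, rho(A) > c holds exactly
    when for some n and some z with rational coordinates, |z| > c + 1/(n+1)
    and |det(z - A)| < (n+1)^(-N): a small determinant at z means that an
    eigenvalue is close to z (spectral_radius_gtP).  This is a countable union
    of events defined by polynomials in the entries. *)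

(** * The modulus of complex numbers *)

Lemma normc_ge0 (R : rcfType) (z : R[i]) : 0 <= Normc.normc z.
Proof. by case: z => x y; exact: sqrtr_ge0. Qed.

Lemma normc_sum (R : rcfType) (I : Type) (r : seq I) (p : pred I)
    (F : I -> R[i]) :
  Normc.normc (\sum_(i <- r | p i) F i) <=
  \sum_(i <- r | p i) Normc.normc (F i).
Proof.
elim/big_ind2: _ => [|x1 x2 y1 y2 h1 h2|//]; first by rewrite Normc.normc0.
exact: le_trans (le_normcD _ _) (lerD h1 h2).
Qed.

Lemma normc_prod (R : rcfType) (I : Type) (r : seq I) (F : I -> R[i]) :
  Normc.normc (\prod_(i <- r) F i) = \prod_(i <- r) Normc.normc (F i).
Proof. exact: (big_morph _ (@Normc.normcM R) (@Normc.normc1 R)). Qed.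

Lemma normcX (R : rcfType) (z : R[i]) (n : nat) :
  Normc.normc (z ^+ n) = Normc.normc z ^+ n.
Proof.
by elim: n => [|n IHn]; rewrite ?Normc.normc1// !exprS Normc.normcM IHn.
Qed.

Lemma normc_real (R : rcfType) (x : R) :
  Normc.normc (real_complex R x) = `|x|.
Proof. by rewrite /= expr0n addr0 sqrtr_sqr. Qed.

Lemma normc_leReIm (R : rcfType) (z : R[i]) :
  Normc.normc z <= `|complex.Re z| + `|complex.Im z|.
Proof.
case: z => x y /=; rewrite -[leRHS]ger0_norm ?addr_ge0// -[leRHS]sqrtr_sqr.
apply: ler_wsqrtr; rewrite sqrrD !real_normK ?num_real// -addrA lerD2l.
by rewrite lerDr mulrn_wge0// mulr_ge0.
Qed.

(** * Eigenvalues of a perturbed shift *)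

Section perturbation.
Context {R : rcfType}.
Implicit Types (N b n : nat).

Definition l1norm {N} (v : 'rV[R[i]]_N) : R := \sum_j Normc.normc (v 0 j).

Lemma l1normB N (u v : 'rV[R[i]]_N) : l1norm (u - v) <= l1norm u + l1norm v.
Proof.
rewrite -big_split/=; apply: ler_sum => j _; rewrite !mxE.
by apply: le_trans (le_normcD _ _) _; rewrite normcN.
Qed.

Lemma l1normZ N z (v : 'rV[R[i]]_N) : l1norm (z *: v) = Normc.normc z * l1norm v.
Proof.
by rewrite mulr_sumr; apply: eq_bigr => j _; rewrite mxE Normc.normcM.
Qed.

Lemma l1norm_gt0 N (v : 'rV[R[i]]_N) : v != 0 -> 0 < l1norm v.
Proof.
case/rV0Pn => j vj; apply: lt_le_trans (_ : 0 < Normc.normc (v 0 j)) _.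
  rewrite lt_neqAle normc_ge0 andbT eq_sym; apply: contra vj => /eqP.
  by move/Normc.eq0_normc ->.
by rewrite /l1norm (bigD1 j)//= lerDl sumr_ge0// => i _; exact: normc_ge0.
Qed.

(** Vectors are rows acted on from the right, so absolute row sums control the
    l1 operator norm. *)
Lemma l1norm_mulmx N (v : 'rV[R[i]]_N) (A : 'M[R[i]]_N) c :
  (forall i, \sum_j Normc.normc (A i j) <= c) ->
  l1norm (v *m A) <= c * l1norm v.
Proof.
move=> hA; apply: le_trans (_ : \sum_j \sum_i Normc.normc (v 0 i * A i j) <= _).
  by apply: ler_sum => j _; rewrite mxE; exact: normc_sum.
rewrite exchange_big mulr_sumr; apply: ler_sum => i _ /=.
under eq_bigr do rewrite Normc.normcM.
by rewrite -mulr_sumr mulrC ler_wpM2r ?normc_ge0.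
Qed.

(** Each row of the shift has at most one nonzero entry, equal to 1. *)
Lemma l1norm_shift N b (v : 'rV[R[i]]_N) :
  l1norm (v *m nilpotent_blocks R[i] b N) <= l1norm v.
Proof.
rewrite -[leRHS]mul1r; apply: l1norm_mulmx => i.
have normcb (c : bool) : Normc.normc (c%:R : R[i]) = c%:R.
  by case: c; rewrite (Normc.normc1, Normc.normc0).
under eq_bigr do rewrite nilpotent_blocksE normcb.
have [iN|Ni] := ltnP i.+1 N.
  rewrite (bigD1 (Ordinal iN))//= big1 ?addr0 ?lern1 ?leq_b1// => j.
  by rewrite -val_eqE/= => /negbTE ->.
rewrite big1// => j _; case: eqP => //= ji.
by move: (ltn_ord j); rewrite ji ltnNge Ni.
Qed.

(** Each application of the shift clears one more coordinate at the beginning of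
    every block: after k steps, the coordinates at position less than k in their
    block are zero. *)
Lemma shift_nilpotent N b (v : 'rV[R[i]]_N) :
  iter b.+1 (mulmxr (nilpotent_blocks R[i] b N)) v = 0.
Proof.
suff h k (j : 'I_N) : (j %% b.+1 < k)%N ->
    (iter k (mulmxr (nilpotent_blocks R[i] b N)) v) 0 j = 0.
  by apply/rowP => j; rewrite h ?ltn_pmod// mxE.
elim: k j => // k IHk j jk; rewrite iterS/= mxE big1// => i _.
rewrite nilpotent_blocksE; case: eqP => //= [ji|_]; last by rewrite mulr0.
have [_|ib] := eqVneq (i %% b.+1)%N b; rewrite ?mulr0//=.
rewrite IHk ?mul0r// -ltnS; apply: leq_trans jk; rewrite ltnS ji.
suff -> : (i.+1 %% b.+1 = (i %% b.+1).+1)%N by [].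
rewrite -addn1 -modnDml addn1 modn_small// ltn_neqAle eqSS ib.
by rewrite ltn_pmod.
Qed.

(** With T the shift and v an eigenvector, the error z^n v - v T^n grows at each
    step by at most the l1 norm of z^n (v A), hence is bounded by a geometric
    sum; at n = b+1 the term v T^n is gone and the error is z^(b+1) v itself. *)
Lemma eigenvalue_pow_le N b (A : 'M[R[i]]_N) (K : R) (z : R[i]) :
  (forall i, \sum_j Normc.normc (A i j) <= K) ->
  eigenvalue (nilpotent_blocks R[i] b N + A) z ->
  Normc.normc z ^+ b.+1 <= K * \sum_(k < b.+1) Normc.normc z ^+ k.
Proof.
move=> hA /eigenvalueP[v vz v0].
pose f : 'rV[R[i]]_N -> 'rV[R[i]]_N := mulmxr (nilpotent_blocks R[i] b N).
have fv : f v = z *: v - v *m A by rewrite -vz mulmxDr addrK.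
have h n : l1norm (z ^+ n *: v - iter n f v) <=
    (\sum_(k < n) Normc.normc z ^+ k) * (K * l1norm v).
  elim: n => [|n IHn].
    rewrite big_ord0 mul0r expr0 scale1r subrr /l1norm big1// => j _.
    by rewrite mxE Normc.normc0.
  (* z^(n+1) v - v T^(n+1) = (z^n v - v T^n) T + z^n (v A) *)
  have -> : z ^+ n.+1 *: v - iter n.+1 f v =
      f (z ^+ n *: v - iter n f v) - (- z ^+ n) *: (v *m A).
    rewrite iterS [f (_ - _)]mulmxBl -scalemxAl -![_ *m nilpotent_blocks _ _ _]/(f _).
    by rewrite fv scaleNr opprK scalerBr scalerA exprSr addrAC subrK.
  apply: le_trans (l1normB _ _ _) _; rewrite big_ord_recr/= mulrDl.
  apply: lerD; first exact: le_trans (l1norm_shift _ _ _) IHn.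
  by rewrite l1normZ normcN normcX ler_wpM2l ?exprn_ge0 ?normc_ge0// l1norm_mulmx.
have := h b.+1; rewrite shift_nilpotent subr0 l1normZ normcX mulrA.
by rewrite ler_pM2r ?l1norm_gt0// mulrC.
Qed.

End perturbation.

(** If r > 1, every term of the sum is at most r^b and dividing by r^b gives
    r <= a (b+1) <= 1; so r <= 1 and every term is at most 1. *)
Lemma pow_le_geometric (R : realFieldType) (r a : R) (b : nat) :
  0 <= r -> 0 <= a -> a * b.+1%:R <= 1 ->
  r ^+ b.+1 <= a * \sum_(k < b.+1) r ^+ k -> r ^+ b.+1 <= a * b.+1%:R.
Proof.
move=> r0 a0 ab1 h; have [r1|r1] := leP r 1.
  apply: le_trans h _; rewrite ler_wpM2l// -[b.+1 in leRHS]card_ord.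
  rewrite -sumr_const; apply: ler_sum => k _; exact: exprn_ile1.
suff : r <= 1 by rewrite leNgt r1.
have rb : 0 < r ^+ b by rewrite exprn_gt0// (lt_trans ltr01).
rewrite -(ler_pM2r rb) -exprS mul1r; apply: le_trans h _.
apply: le_trans (_ : a * (b.+1%:R * r ^+ b) <= _); last first.
  by rewrite mulrA ger_pMl.
rewrite ler_wpM2l// -[b.+1 in leRHS]card_ord mulr_natl -sumr_const.
by apply: ler_sum => k _; rewrite ler_weXn2l ?(ltW r1)// -ltnS.
Qed.

(** * The spectral radius and the characteristic determinant *)

Section spectrum.
Context {R : realType} {N : nat}.
Implicit Types (A : 'M[R[i]]_N) (z : R[i]) (c e : R).

Lemma char_poly_horner A z : (char_poly A).[z] = \det (z%:M - A).
Proof.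
rewrite -horner_evalE -det_map_mx; congr (\det _); apply/matrixP => i j.
by rewrite !mxE /= /horner_eval hornerD hornerN hornerC hornerMn hornerX.
Qed.

Lemma det_sub_eigenvalues A : {r : seq R[i] |
  [/\ size r = N, forall z, eigenvalue A z = (z \in r) &
      forall z, \det (z%:M - A) = \prod_(x <- r) (z - x)] }.
Proof.
have [r pr] := closed_field_poly_normal (char_poly A).
have mA := char_poly_monic A; have sA := size_char_poly A.
rewrite (monicP mA) scale1r in pr; exists r; split.
- by apply/eqP; rewrite -eqSS -sA pr size_prod_XsubC.
- by move=> z; rewrite eigenvalue_root_char pr root_prod_XsubC.
- move=> z; rewrite -char_poly_horner pr horner_prod.
  by apply: eq_bigr => x _; rewrite hornerXsubC.
Qed.

(** The hypothesis on c covers the empty matrix, whose spectral radius is the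
    supremum of the empty set, that is 0. *)
Lemma spectral_radius_leP A c : 0 <= c ->
  (spectral_radius A <= c) <->
  (forall z, eigenvalue A z -> Normc.normc z <= c).
Proof.
move=> c0; have [r [_ rA _]] := det_sub_eigenvalues A; split=> [h z Az|h].
  apply: le_trans h; apply: ub_le_sup; last by exists z.
  exists (\sum_(x <- r) Normc.normc x) => _ [y /= Ay <-].
  by rewrite (big_rem y) -?rA//= lerDl sumr_ge0// => x _; exact: normc_ge0.
have [E0|/set0P E0] := eqVneq [set Normc.normc z | z in [set z | eigenvalue A z]] set0.
  by rewrite /spectral_radius E0 sup0.
by apply: ge_sup => // _ [z /= Az <-]; exact: h.
Qed.

(** The determinant is the product of the N distances from z to the eigenvalues,
    so one of them is small when the product is. *)
Lemma near_eigenvalue A z e : 0 <= e ->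
  Normc.normc (\det (z%:M - A)) < e ^+ N ->
  exists2 x, eigenvalue A x & Normc.normc (z - x) < e.
Proof.
move=> e0; have [r [sr rA ->]] := det_sub_eigenvalues A.
rewrite normc_prod => h; apply: contrapT => hn.
suff : e ^+ N <= \prod_(x <- r) Normc.normc (z - x) by rewrite leNgt h.
have -> : e ^+ N = \prod_(x <- r) e.
  by rewrite big_const_seq count_predT iter_mulr_1 sr.
rewrite big_seq [leRHS]big_seq.
apply: ler_prod => x xr; rewrite e0/= leNgt; apply/negP => zx.
by apply: hn; exists x => //; rewrite rA.
Qed.

(** A quantitative form of the continuity of the determinant at an eigenvalue:
    one factor of the product is the distance from z to x, and the others are
    bounded for z in the unit disc around x. *)
Lemma det_near_eigenvalue A x : eigenvalue A x -> exists2 C : R, 0 < C &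
  forall z, Normc.normc (z - x) <= 1 ->
    Normc.normc (\det (z%:M - A)) <= C * Normc.normc (z - x).
Proof.
have [r [_ -> rdet]] := det_sub_eigenvalues A; move=> xr.
exists (\prod_(y <- rem x r) (1 + Normc.normc (x - y))).
  by apply: prodr_gt0 => y _; rewrite ltr_wpDr ?normc_ge0.
move=> z zx1; rewrite rdet normc_prod (big_rem x)//= mulrC.
rewrite ler_wpM2r ?normc_ge0//; apply: ler_prod => y _; rewrite normc_ge0/=.
have -> : z - y = (z - x) + (x - y) by rewrite addrA subrK.
by apply: le_trans (le_normcD _ _) _; rewrite lerD2r.
Qed.

Definition qcomplex (q : rat * rat) : R[i] := Complex (ratr q.1) (ratr q.2).

Lemma qcomplex_dense z e : 0 < e -> exists q, Normc.normc (qcomplex q - z) < e.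
Proof.
case: z => x y e0.
have ratP (u : R) : exists q : rat, `|ratr q - u| < e / 2.
  have /rat_in_itvoo[q] : u - e / 2 < u + e / 2 by lra.
  by rewrite in_itv/= => /andP[? ?]; exists q; rewrite ltr_norml; lra.
have [[p hp] [q hq]] := (ratP x, ratP y); exists (p, q).
apply: le_lt_trans; first exact: normc_leReIm.
by rewrite [e]splitr; exact: ltrD.
Qed.

(** Countably many conditions on determinants decide whether the spectral radius
    exceeds c.  The same n is used in both inequalities: the eigenvalue found
    within 1/(n+1) of z still has modulus greater than c. *)
Lemma spectral_radius_gtP A c : 0 <= c ->
  (c < spectral_radius A) <->
  exists q n, c + n.+1%:R^-1 < Normc.normc (qcomplex q) /\
    Normc.normc (\det ((qcomplex q)%:M - A)) < n.+1%:R^-1 ^+ N.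
Proof.
move=> c0; split=> [|[q [n [cq hq]]]]; last first.
  have [|x Ax qx] := near_eigenvalue _ _ _ _ hq; first by rewrite invr_ge0.
  rewrite ltNge; apply/negP => /(spectral_radius_leP _ _ c0)/(_ _ Ax) xc.
  have : Normc.normc (qcomplex q) <= Normc.normc (qcomplex q - x) + Normc.normc x.
    rewrite -[in leLHS](subrK x (qcomplex q)); exact: le_normcD.
  by move/le_trans => /(_ _ (lerD (ltW qx) xc)); rewrite leNgt addrC cq.
rewrite ltNge => /negP h.
have [x Ax cx] : exists2 x, eigenvalue A x & c < Normc.normc x.
  apply: contrapT => hx; apply/h/spectral_radius_leP => // x Ax.
  by rewrite leNgt; apply/negP => cx; apply: hx; exists x.
(* m is chosen so that |x| > c + 2/(m+1), leaving 1/(m+1) for the distance to q *)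
pose m : nat := Num.trunc (2 / (Normc.normc x - c)).
have m0 : 0 < m.+1%:R^-1 :> R by rewrite invr_gt0.
have hm : 2 * m.+1%:R^-1 < Normc.normc x - c.
  have := truncnS_gt (2 / (Normc.normc x - c)).
  by rewrite -/m ltr_pdivrMr ?subr_gt0// ltr_pdivrMr// mulrC.
have [C C0 hC] := det_near_eigenvalue _ _ Ax.
have mN : 0 < m.+1%:R^-1 ^+ N :> R by rewrite exprn_gt0.
pose e := Num.min m.+1%:R^-1 (m.+1%:R^-1 ^+ N / C).
have e0 : 0 < e by rewrite lt_min m0 divr_gt0.
have [q] := qcomplex_dense x _ e0.
rewrite lt_min => /andP[qm qC]; exists q, m; split.
  have : Normc.normc x <= Normc.normc (qcomplex q - x) + Normc.normc (qcomplex q).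
    rewrite -[Normc.normc (_ - x)]normcN opprB -[in leLHS](subrK (qcomplex q) x).
    exact: le_normcD.
  move=> xq; rewrite -(ltrD2l m.+1%:R^-1); apply: lt_le_trans (_ : Normc.normc x <= _).
    by rewrite addrCA -mulr2n -[_ *+ 2]mulr_natl -ltrBrDl.
  by apply: le_trans xq _; rewrite lerD2r ltW.
apply: le_lt_trans (hC _ _) _.
  by rewrite (le_trans (ltW qm))// invf_le1// ler1n.
by rewrite mulrC -ltr_pdivlMr.
Qed.

End spectrum.

(** * Measurability of the spectral radius *)

Section measurability.
Context {R : realType} {d : measure_display} {T : measurableType d}.
Implicit Types f g : T -> R[i].

(** Borel measurability under the identification of C with R * R. *)
Definition measurable_reim f := measurable_fun [set: T] (@reim R \o f).

Lemma measurable_reimP f : measurable_reim f <->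
  measurable_fun [set: T] (fun w => complex.Re (f w)) /\
  measurable_fun [set: T] (fun w => complex.Im (f w)).
Proof. exact: measurable_fun_pairP. Qed.

Lemma measurable_reim_cst z : measurable_reim (fun=> z).
Proof. exact: measurable_cst. Qed.

Lemma measurable_reimD f g : measurable_reim f -> measurable_reim g ->
  measurable_reim (fun w => f w + g w).
Proof.
move=> /measurable_reimP[fr fi] /measurable_reimP[gr gi].
apply/measurable_reimP; split.
  rewrite (_ : (fun w => _) = (fun w => complex.Re (f w) + complex.Re (g w))).
    exact: measurable_funD.
  by apply/funext => w; case: (f w) (g w) => [? ?] [? ?].
rewrite (_ : (fun w => _) = (fun w => complex.Im (f w) + complex.Im (g w))).
  exact: measurable_funD.
by apply/funext => w; case: (f w) (g w) => [? ?] [? ?].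
Qed.

Lemma measurable_reimM f g : measurable_reim f -> measurable_reim g ->
  measurable_reim (fun w => f w * g w).
Proof.
move=> /measurable_reimP[fr fi] /measurable_reimP[gr gi].
apply/measurable_reimP; split.
  rewrite (_ : (fun w => _) = (fun w => complex.Re (f w) * complex.Re (g w) -
      complex.Im (f w) * complex.Im (g w))).
    by apply: measurable_funB; exact: measurable_funM.
  by apply/funext => w; case: (f w) (g w) => [? ?] [? ?].
rewrite (_ : (fun w => _) = (fun w => complex.Re (f w) * complex.Im (g w) +
    complex.Im (f w) * complex.Re (g w))).
  by apply: measurable_funD; exact: measurable_funM.
by apply/funext => w; case: (f w) (g w) => [? ?] [? ?].
Qed.

Lemma measurable_reim_sum (I : Type) (r : seq I) (F : I -> T -> R[i]) :
  (forall i, measurable_reim (F i)) ->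
  measurable_reim (fun w => \sum_(i <- r) F i w).
Proof.
move=> mF; elim: r => [|i r IHr].
  by under eq_fun do rewrite big_nil; exact: measurable_reim_cst.
by under eq_fun do rewrite big_cons; exact: measurable_reimD.
Qed.

Lemma measurable_reim_prod (I : Type) (r : seq I) (F : I -> T -> R[i]) :
  (forall i, measurable_reim (F i)) ->
  measurable_reim (fun w => \prod_(i <- r) F i w).
Proof.
move=> mF; elim: r => [|i r IHr].
  by under eq_fun do rewrite big_nil; exact: measurable_reim_cst.
by under eq_fun do rewrite big_cons; exact: measurable_reimM.
Qed.

Lemma measurable_reim_det N (A : T -> 'M[R[i]]_N) :
  (forall i j, measurable_reim (fun w => A w i j)) ->
  measurable_reim (fun w => \det (A w)).
Proof.
move=> mA; apply: measurable_reim_sum => s; apply: measurable_reimM.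
  exact: measurable_reim_cst.
by apply: measurable_reim_prod => i; exact: mA.
Qed.

Lemma measurable_normc f : measurable_reim f ->
  measurable_fun [set: T] (fun w => Normc.normc (f w)).
Proof.
move=> /measurable_reimP[fr fi].
rewrite (_ : (fun w => _) =
  Num.sqrt \o (fun w => complex.Re (f w) ^+ 2 + complex.Im (f w) ^+ 2)); last first.
  by apply/funext => w /=; case: (f w).
apply: measurableT_comp.
  exact: continuous_measurable_fun (@sqrt_continuous R).
by apply: measurable_funD; exact: measurable_funX.
Qed.

Lemma measurable_spectral_radius_le N (A : T -> 'M[R[i]]_N) (c : R) : 0 <= c ->
  (forall i j, measurable_reim (fun w => A w i j)) ->
  measurable [set w | spectral_radius (A w) <= c].
Proof.
move=> c0 mA; rewrite -[X in measurable X]setCK; apply: measurableC.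
pose bad (u : rat * rat * nat) :=
  [set w | c + u.2.+1%:R^-1 < Normc.normc (qcomplex u.1 : R[i]) /\
     Normc.normc (\det ((qcomplex u.1)%:M - A w)) < u.2.+1%:R^-1 ^+ N].
rewrite (_ : ~` _ = \bigcup_u bad u); last first.
  apply/seteqP; split=> w /=.
    move/negP; rewrite -ltNge => /spectral_radius_gtP[//|q [n h]].
    by exists (q, n).
  case=> -[q n] _ h; apply/negP; rewrite -ltNge; apply/spectral_radius_gtP => //.
  by exists q, n.
apply: countable_bigcupT_measurable => [|[q n]]; first exact: countableP.
have [qc|qc] := boolP (c + n.+1%:R^-1 < Normc.normc (qcomplex q : R[i])); last first.
  rewrite (_ : bad _ = set0)//; apply/seteqP; split=> w //= -[].
  by rewrite (negbTE qc).
rewrite (_ : bad _ =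
  [set w | Normc.normc (\det ((qcomplex q)%:M - A w)) < n.+1%:R^-1 ^+ N]); last first.
  by apply/seteqP; split=> w /= => [[]|].
rewrite -[X in measurable X]setTI -[X in _ `&` X]preimage_itvNyo.
apply: measurable_normc => //; apply: measurable_reim_det => i j.
under eq_fun do rewrite !mxE -[- A _ _ _]mulN1r.
apply: measurable_reimD; first exact: measurable_reim_cst.
by apply: measurable_reimM => //; exact: measurable_reim_cst.
Qed.

End measurability.

(** * The deterministic bound on the spectral radius *)

Section real_bounds.
Context {R : realType}.

Lemma ln_le_sqrt (y : R) : 0 < y -> ln y <= 2 * Num.sqrt y.
Proof.
move=> y0; have sy0 : 0 < Num.sqrt y by rewrite sqrtr_gt0.
rewrite -[in leLHS](sqr_sqrtr (ltW y0)) lnXn// -[ln _ *+ 2]mulr_natl ler_wpM2l//.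
exact/ltW/ln_sublinear.
Qed.

(** The excess, in the exponent, of the bound actually obtained for the spectral
    radius over - gamma + 2 ln N / b. *)
Definition radius_exponent (gamma : R) (b : nat) : R :=
  (gamma + ln b.+1%:R) / b.+1%:R.

Lemma radius_exponent_ge0 gamma b : 0 <= gamma -> 0 <= radius_exponent gamma b.
Proof. by move=> g0; rewrite divr_ge0// addr_ge0// ln_ge0// ler1n. Qed.

Lemma radius_exponent_le gamma b : 0 <= gamma ->
  radius_exponent gamma b <= (gamma + 2) / Num.sqrt b.+1%:R.
Proof.
move=> g0; set y : R := b.+1%:R.
have y0 : 0 < y by rewrite ltr0n.
have sy0 : 0 < Num.sqrt y by rewrite sqrtr_gt0.
have sy1 : 1 <= Num.sqrt y by rewrite -sqrtr1 ler_wsqrtr// ler1n.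
rewrite /radius_exponent -/y ler_pdivrMr// mulrAC -mulrA.
have -> : y / Num.sqrt y = Num.sqrt y.
  by rewrite -[in X in X / _](sqr_sqrtr (ltW y0)) expr2 mulfK ?gt_eqF.
rewrite mulrDl lerD ?ln_le_sqrt//; by rewrite ler_peMr.
Qed.

(** Here eigenvalue_pow_le is used with K = exp(- gamma b) N^2.  With
    x = - gamma + 2 ln N / b in [- gamma, 0] and eta the radius exponent, the
    bound r <= exp (x + eta) is turned into an additive error by
    exp (x + eta) <= exp x + (exp eta - 1), which uses exp x <= 1. *)
Lemma spectral_radius_shift_le (N b : nat) (gamma : R) (G : 'M[R[i]]_N) :
  (0 < N)%N -> (0 < b)%N -> ln (N%:R : R) <= b%:R -> 5%:R / 2%:R < gamma ->
  ln (b.+1%:R : R) <= b%:R / 2 ->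
  (forall i j, Normc.normc (G i j) <= N%:R) ->
  spectral_radius (nilpotent_blocks R[i] b N +
    (real_complex R (expR (- gamma * b%:R))) *: G) <=
  expR (- gamma + 2%:R * ln (N%:R : R) / b%:R) +
    (expR (radius_exponent gamma b) - 1).
Proof.
move=> N0 b0 Nb hg hb hG.
have b0' : 0 < b%:R :> R by rewrite ltr0n.
have N0' : 0 < N%:R :> R by rewrite ltr0n.
set L := ln _ in Nb *; set x := - gamma + _; set eta := radius_exponent _ _.
have eta0 : 0 <= eta by rewrite radius_exponent_ge0//; lra.
have LE : expR L = N%:R by rewrite lnK.
have Lb : L / b%:R <= 1 by rewrite ler_pdivrMr// mul1r.
have xb : x * b%:R = - gamma * b%:R + 2 * L.
  by rewrite /x mulrDl divfK// gt_eqF.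
have L0 : 0 <= L by rewrite ln_ge0// ler1n.
have x_ge : - gamma <= x by rewrite /x lerDl divr_ge0// ?ler0n// mulr_ge0.
have x0 : x <= 0 by rewrite /x -mulrA; lra.
apply: (@le_trans _ _ (expR (x + eta))); last first.
  have e1 : expR x <= 1 by rewrite -[leRHS]expR0 ler_expR.
  have e2 : 1 <= expR eta by rewrite -[leLHS]expR0 ler_expR.
  (* the difference of the two sides is (1 - exp x) (exp eta - 1) *)
  have := mulr_ge0 (_ : 0 <= 1 - expR x) (_ : 0 <= expR eta - 1).
  rewrite !subr_ge0 [expR (x + eta)]expRD -[X in _ -> is_true X]subr_ge0 => /(_ e1 e2).
  by congr (is_true (0 <= _)) ; ring.
apply/spectral_radius_leP => [|z]; first exact: expR_ge0.
pose a := expR (- gamma * b%:R) * (N%:R * N%:R).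
move=> /(@eigenvalue_pow_le _ _ _ _ a)/=.
have aE : a * b.+1%:R = expR (- gamma * b%:R + 2 * L + ln b.+1%:R).
  by rewrite !expRD (lnK _) ?posrE ?ltr0n// mulr_natl mulr2n expRD LE.
have ab1 : a * b.+1%:R <= 1.
  rewrite aE -[leRHS]expR0 ler_expR mulNr; have := ler_wpM2r (ltW b0') (ltW hg).
  move: (gamma * b%:R) (ln b.+1%:R) Nb hb => u v; clear; lra.
have a0 : 0 <= a by rewrite mulr_ge0 ?expR_ge0// mulr_ge0.
have sumG i : \sum_j Normc.normc ((real_complex R (expR (- gamma * b%:R)) *: G) i j) <= a.
  under eq_bigr do rewrite mxE Normc.normcM normc_real ger0_norm ?expR_ge0//.
  rewrite -mulr_sumr ler_wpM2l ?expR_ge0//.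
  apply: le_trans (_ : \sum_(j < N) N%:R <= _); first exact: ler_sum.
  by rewrite sumr_const card_ord mulr_natl.
move=> /(_ sumG)/(pow_le_geometric _ _ _ _ (normc_ge0 _ _) a0 ab1).
move=> rab; suff ab : a * b.+1%:R <= expR (x + eta) ^+ b.+1.
  rewrite -(ler_pXn2r (ltn0Sn b)) ?nnegrE ?normc_ge0 ?expR_ge0//.
  exact: le_trans rab ab.
rewrite -expRM_natl aE ler_expR mulrDr [_ * eta]mulrC divfK ?pnatr_eq0//.
have -> : b.+1%:R * x = x * b%:R + x by rewrite -natr1 mulrDl mul1r mulrC.
rewrite -xb.
by move: (x * b%:R) (ln _) x_ge => u v; clear; lra.
Qed.

End real_bounds.

(** * Gaussian tails *)

Lemma measurable_norm_gt (R : realType) (t : R) :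
  measurable ([set x | t < `|x|] : set (measurableTypeR R)).
Proof.
rewrite -preimage_itvoy -[X in measurable X]setTI.
by apply: normr_measurable => //.
Qed.

(** Comparison with the normal density of standard deviation 2 s: the ratio of
    the two densities at x is 2 exp (- 3 x^2 / (8 s^2)), which is at most the
    stated bound where |x| > t, and the wider density has total mass 1. *)
Lemma normal_tail (R : realType) (s t : R) : s != 0 -> 0 <= t ->
  (normal_prob 0 s [set x : R | (t < `|x|)%R] <=
   (2 * expR (- (t ^+ 2 / (4 * s ^+ 2))))%:E)%E.
Proof.
move=> s0 t0; set c := 2 * _.
have s2 : 2 * s != 0 by rewrite mulf_neq0.
have c0 : 0 <= c by rewrite mulr_ge0 ?expR_ge0.
pose V := [set x : R | t < `|x|].
have mV : measurable (V : set (measurableTypeR R)) := measurable_norm_gt _ _.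
have mpdf (u : R) : measurable_fun V (EFin \o normal_pdf 0 u).
  by apply: measurable_funTS; apply/measurable_EFinP; exact: measurable_normal_pdf.
have pdf_le (x : R) : V x -> normal_pdf 0 s x <= c * normal_pdf 0 (2 * s) x.
  rewrite /V/= => tx; rewrite !normal_pdfE//.
  have peak2 : normal_peak (2 * s) = 2^-1 * normal_peak s.
    rewrite /normal_peak -invfM; congr (_^-1).
    rewrite exprMn -mulrA -mulrnAr sqrtrM ?sqr_ge0// sqrtr_sqr normr_nat.
    by [].
  set F := normal_fun 0 (2 * s) x.
  have -> : c * (normal_peak (2 * s) * F) =
      normal_peak s * (expR (- (t ^+ 2 / (4 * s ^+ 2))) * F).
    by rewrite peak2 /c; move: (normal_peak s) (expR _) F => p u v; field.
  rewrite ler_wpM2l ?normal_peak_ge0// /F.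
  rewrite /normal_fun -expRD ler_expR !subr0.
  have x2 : t ^+ 2 <= x ^+ 2.
    by rewrite -[x ^+ 2]real_normK ?num_real// lerXn2r ?nnegrE// ltW.
  have : t ^+ 2 / s ^+ 2 <= x ^+ 2 / s ^+ 2 by rewrite ler_wpM2r ?invr_ge0 ?sqr_ge0.
  have -> : - x ^+ 2 / (s ^+ 2 *+ 2) = - (x ^+ 2 / s ^+ 2) / 2.
    by clear -s0; field.
  have -> : - x ^+ 2 / ((2 * s) ^+ 2 *+ 2) = - (x ^+ 2 / s ^+ 2) / 8.
    by clear -s0; field.
  have -> : t ^+ 2 / (4 * s ^+ 2) = (t ^+ 2 / s ^+ 2) / 4.
    by clear -s0; field.
  have : 0 <= t ^+ 2 / s ^+ 2 by rewrite divr_ge0 ?sqr_ge0.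
  move: (t ^+ 2 / s ^+ 2) (x ^+ 2 / s ^+ 2) => u v; clear; lra.
apply: (@le_trans _ _ (\int[lebesgue_measure]_(x in V)
    (c%:E * (normal_pdf 0 (2 * s) x)%:E))%E).
  apply: ge0_le_integral => //=.
  - by move=> x _; rewrite lee_fin normal_pdf_ge0.
  - exact: mpdf.
  - by apply: measurable_funeM; exact: mpdf.
rewrite ge0_integralZl//=.
- rewrite -[leRHS]mule1 lee_wpmul2l//.
  exact: (probability_le1 (normal_prob 0 (2 * s)) mV).
- exact: mpdf.
- by move=> x _; rewrite lee_fin normal_pdf_ge0.
Qed.

Lemma std_gaussian_tail (R : realType) (k : gaussian_kind) (t : R) : 0 <= t ->
  (std_gaussian k [set x : R * R | (t < `|x.1|)%R] <=
     (2 * expR (- (t ^+ 2 / 4)))%:E)%E /\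
  (std_gaussian k [set x : R * R | (t < `|x.2|)%R] <=
     (2 * expR (- (t ^+ 2 / 4)))%:E)%E.
Proof.
move=> t0; pose V := [set x : R | t < `|x|].
have mV : measurable (V : set (measurableTypeR R)) := measurable_norm_gt _ _.
have -> : [set x : R * R | t < `|x.1|] = V `*` setT.
  by apply/seteqP; split=> x //= [].
have -> : [set x : R * R | t < `|x.2|] = setT `*` V.
  by apply/seteqP; split=> x //= [].
have tail (s : R) : s != 0 -> s ^+ 2 <= 1 ->
    (normal_prob 0 s V <= (2 * expR (- (t ^+ 2 / 4)))%:E)%E.
  move=> s0 s1; apply: le_trans (normal_tail _ _ _ s0 t0) _.
  rewrite lee_fin ler_wpM2l// ler_expR lerN2 ler_wpM2l ?sqr_ge0//.
  have s2 : 0 < s ^+ 2 by rewrite exprn_even_gt0.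
  have s4 : 0 < 4 * s ^+ 2 by rewrite mulr_gt0.
  by rewrite lef_pV2 ?posrE// ger_pMr.
case: k => /=.
  split; rewrite product_measure1E//=.
    by rewrite diracT mule1 tail ?oner_neq0// expr1n.
  rewrite diracE memNset ?mule0 ?lee_fin ?mulr_ge0 ?expR_ge0//.
  by rewrite /V/= normr0; apply/negP; rewrite -leNgt.
have s0 : Num.sqrt 2^-1 != 0 :> R by rewrite gt_eqF// sqrtr_gt0 invr_gt0.
have s1 : (Num.sqrt 2^-1) ^+ 2 <= 1 :> R.
  by rewrite sqr_sqrtr ?invr_ge0// invf_le1// ler1n.
split; rewrite product_measure1E//=.
  rewrite [X in (_ * X)%E]probability_setT mule1; exact: tail.
rewrite [X in (X * _)%E]probability_setT mul1e; exact: tail.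
Qed.

Lemma le_measure_bigsetU (d : measure_display) (R : realType)
    (T : measurableType d) (mu : {measure set T -> \bar R}) (I : Type)
    (r : seq I) (F : I -> set T) : (forall i, measurable (F i)) ->
  (mu (\big[setU/set0]_(i <- r) F i) <= \sum_(i <- r) mu (F i))%E.
Proof.
move=> mF; elim: r => [|i r IHr]; first by rewrite !big_nil measure0.
rewrite !big_cons; apply: le_trans (measureU2 _ _ _) _ => //.
  by apply: bigsetU_measurable.
exact: leeD2l.
Qed.

(** The union bound over real and imaginary parts of all entries:
    the complement of E is the union of the 2 N^2 events where one of them
    exceeds t, each of probability at most 2 exp (- t^2 / 4). *)
Lemma gaussian_entries_le (R : realType) (d : measure_display)
    (T : measurableType d) (P : probability T R) (k : gaussian_kind) (N : nat)
    (G : T -> 'M[R[i]]_N) (t : R) : iid_gaussian_mx P k G -> 0 <= t ->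
  exists2 E : set T, measurable E &
    (forall w, E w -> forall i j, Normc.normc (G w i j) <= t + t) /\
    ((1 - (N * N)%:R * (4 * expR (- (t ^+ 2 / 4))))%:E <= P E)%E.
Proof.
move=> [mG GP _] t0.
pose B1 : set (R * R) := [set x | t < `|x.1|].
pose B2 : set (R * R) := [set x | t < `|x.2|].
have mB1 : measurable B1.
  rewrite (_ : B1 = [set x | t < `|x|] `*` setT); last first.
    by apply/seteqP; split=> x //= [].
  by apply: measurableX => //; exact: measurable_norm_gt.
have mB2 : measurable B2.
  rewrite (_ : B2 = setT `*` [set x | t < `|x|]); last first.
    by apply/seteqP; split=> x //= [].
  by apply: measurableX => //; exact: measurable_norm_gt.
pose X (p : 'I_N * 'I_N) w := reim (G w p.1 p.2).
have mX p B : measurable B -> measurable (X p @^-1` B).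
  by move=> mB; rewrite -[X in measurable X]setTI; exact: mG.
pose F p := X p @^-1` B1 `|` X p @^-1` B2.
have mF p : measurable (F p) by apply: measurableU; exact: mX.
pose bad := \big[setU/set0]_(p : 'I_N * 'I_N) F p.
have mbad : measurable bad by exact: bigsetU_measurable.
exists (~` bad); first exact: measurableC.
split=> [w /= nbad i j|].
  have hF : ~ F (i, j) w.
    by move=> Fw; apply: nbad; rewrite /bad -bigcup_seq; exists (i, j) => //=; exact: mem_index_enum.
  apply: le_trans; first exact: normc_leReIm.
  apply: lerD; rewrite leNgt; apply/negP => h; apply: hF; [by left|by right].
rewrite probability_setC// EFinB leeB//.
apply: (le_trans (le_measure_bigsetU _ _ _ _ _ _ _ mF)).
apply: (@le_trans _ _ (\sum_(p : 'I_N * 'I_N) (4 * expR (- (t ^+ 2 / 4)))%:E)%E).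
  apply: lee_sum => p _; apply: (le_trans (measureU2 _ _ _)) => //; try exact: mX.
  have [h1 h2] := std_gaussian_tail _ k _ t0.
  (* the factor 4 is twice the factor 2 of the tail: real and imaginary parts *)
  rewrite (_ : 4 * _ = 2 * expR (- (t ^+ 2 / 4)) + 2 * expR (- (t ^+ 2 / 4))); last first.
    by rewrite -mulrDl; congr (_ * _); rewrite -natrD.
  by rewrite EFinD; apply: leeD; rewrite [X in (X <= _)%E]GP.
by rewrite sumEFin lee_fin sumr_const card_prod card_ord [leRHS]mulr_natl.
Qed.

(** The threshold N/2 is the one for which real and imaginary parts add up to N.
    The quadratic term of the exponential series already beats N^2. *)
Lemma union_bound_le (R : realType) (N : nat) : (0 < N)%N ->
  (N * N)%:R * (4 * expR (- ((N%:R / 2) ^+ 2 / 4))) <= 4096 * harmonic N :> R.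
Proof.
move=> N0; have N1 : 1 <= N%:R :> R by rewrite ler1n.
have -> : harmonic N = (N%:R + 1)^-1 :> R by rewrite /harmonic/= natr1.
rewrite natrM; move: N1; move: (N%:R : R) => n n1.
have n0 : 0 < n by exact: lt_le_trans n1.
pose y : R := n ^+ 2 / 16.
have y0 : 0 < y by rewrite divr_gt0// exprn_gt0.
have -> : (n / 2) ^+ 2 / 4 = y by rewrite /y; field.
have ey : expR (- y) <= 2 / y ^+ 2.
  rewrite expRN -[leRHS]invrK lef_pV2 ?posrE ?expR_gt0 ?invr_gt0 ?divr_gt0 ?exprn_gt0//.
  rewrite invfM invrK mulrC; apply: le_trans (expR_ge1Dxn 1 (ltW y0)).
  by rewrite lerDr.
apply: (@le_trans _ _ (n * n * (4 * (2 / y ^+ 2)))).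
  by rewrite !ler_wpM2l// mulr_ge0// ltW.
have -> : n * n * (4 * (2 / y ^+ 2)) = 2048 / n ^+ 2.
  by rewrite /y; field; rewrite gt_eqF.
rewrite ler_pdivrMr ?exprn_gt0// mulrAC ler_pdivlMr ?ltr_wpDr//.
by rewrite expr2; clear -n1; nra.
Qed.

(** * The limit in N *)

Lemma near_growing (R : realType) (b : nat -> nat) :
  (forall N : nat, (0 < N)%N -> ln (N%:R : R) <= (b N)%:R) ->
  forall M : R, \forall N \near \oo, (0 < N)%N /\ M < (b N)%:R.
Proof.
move=> hb M; exists (Num.trunc (expR M)).+1 => // N /= hN.
have N0 : (0 < N)%N by exact: leq_trans hN.
split=> //; apply: lt_le_trans (hb _ N0).
rewrite -ltr_expR lnK ?posrE ?ltr0n//.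
by apply: lt_le_trans (truncnS_gt _) _; rewrite ler_nat.
Qed.

(** By ln y <= 2 sqrt y the exponent is at most (gamma + 2) / sqrt (b+1). *)
Lemma cvg_radius_exponent (R : realType) (gamma : R) (b : nat -> nat) :
  0 <= gamma -> (forall M : R, \forall N \near \oo, M < (b N)%:R) ->
  radius_exponent gamma (b N) @[N --> \oo] --> (0 : R).
Proof.
move=> g0 hb; apply/cvgr0Pnorm_lt => e e0.
near=> N.
rewrite ger0_norm ?radius_exponent_ge0//.
apply: le_lt_trans (radius_exponent_le _ _ g0) _.
rewrite ltr_pdivrMr ?sqrtr_gt0 ?ltr0n// mulrC -ltr_pdivrMr//.
have : ((gamma + 2) / e) ^+ 2 < (b N)%:R by near: N; exact: hb.
have ge0 : 0 <= (gamma + 2) / e by rewrite divr_ge0 ?addr_ge0// ltW.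
move=> h; rewrite -[ltLHS]ger0_norm// -sqrtr_sqr ltr_sqrt ?ltr0n//.
by apply: lt_trans h _; rewrite ltr_nat.
Unshelve. all: by end_near. Qed.

Theorem corollary8 (R : realType) (k : gaussian_kind)
    (d : nat -> measure_display) (T : forall N : nat, measurableType (d N))
    (P : forall N : nat, probability (T N) R)
    (G : forall N : nat, T N -> 'M[R[i]]_N)
    (hG : forall N : nat, iid_gaussian_mx (P N) k (G N))
    (b : nat -> nat)
    (hb0 : forall N : nat, (0 < N)%N -> (0 < b N)%N)
    (hb : forall N : nat, (0 < N)%N -> ln (N%:R : R) <= (b N)%:R)
    (gamma : R) (hgamma : 5%:R / 2%:R < gamma) :
  exists eps : nat -> R,
    [/\ eps @ \oo --> (0 : R),
        P N [set w : T N |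
             spectral_radius
               (nilpotent_blocks R[i] (b N) N +
                (real_complex R (expR (- gamma * (b N)%:R))) *: G N w)
             <= expR (- gamma + 2%:R * ln (N%:R : R) / (b N)%:R) + eps N]
          @[N --> \oo] --> (1%:E : \bar R),
        (limn_esup (fun N : nat =>
             (expR (- gamma + 2%:R * ln (N%:R : R) / (b N)%:R) + eps N)%:E)
          < (expR (- (1 / 2%:R)))%:E)%E
      & expR (- (1 / 2%:R)) < 1 :> R].
Proof.
have g0 : 0 <= gamma by lra.
have bN := near_growing _ _ hb.
pose eps N : R := expR (radius_exponent gamma (b N)) - 1.
have eps0 : eps @ \oo --> (0 : R).
  have -> : (0 : R) = expR 0 - 1 by rewrite expR0 subrr.
  apply: cvgB; last exact: cvg_cst.
  apply: continuous_cvg; first exact: continuous_expR.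
  by apply: cvg_radius_exponent => // M; apply: filterS (bN M) => N [].
have eps_ge0 N : 0 <= eps N.
  by rewrite subr_ge0 -[leLHS]expR0 ler_expR radius_exponent_ge0.
exists eps; split=> //.
- apply: (@squeeze_cvge _ _ _ _ (fun N => (1 - 4096 * harmonic N)%:E) _ (cst 1%E)).
  + near=> N.
    have [N0 b17] : (0 < N)%N /\ 17 < (b N)%:R :> R by near: N; exact: bN.
    have mE : measurable [set w : T N | spectral_radius
        (nilpotent_blocks R[i] (b N) N +
         (real_complex R (expR (- gamma * (b N)%:R))) *: G N w) <=
        expR (- gamma + 2%:R * ln (N%:R : R) / (b N)%:R) + eps N].
      apply: measurable_spectral_radius_le => [|i j]; first by rewrite addr_ge0 ?expR_ge0.
      rewrite (_ : (fun w => _) = (fun w => nilpotent_blocks R[i] (b N) N i j +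
          real_complex R (expR (- gamma * (b N)%:R)) * G N w i j)); last first.
        by apply/funext => w; rewrite !mxE.
      apply: measurable_reimD; first exact: measurable_reim_cst.
      apply: measurable_reimM; first exact: measurable_reim_cst.
      by have [mG _ _] := hG N; exact: mG.
    rewrite probability_le1// andbT.
    have t0 : 0 <= N%:R / 2 :> R by rewrite divr_ge0.
    have [E mE' [GE PE]] := gaussian_entries_le _ _ _ _ _ _ _ _ (hG N) t0.
    apply: (@le_trans _ _ (P N E)).
      by apply: le_trans PE; rewrite lee_fin lerB// union_bound_le.
    apply: le_measure; rewrite ?inE// => w Ew /=.
    apply: spectral_radius_shift_le => //.
    * exact: hb0.
    * exact: hb.
    * (* 2 sqrt (b+1) <= b/2 as soon as b > 17 *)
      apply: le_trans (ln_le_sqrt _ _) _; rewrite ?ltr0n//.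
      rewrite -ler_pdivlMl// -[leRHS]ger0_norm ?divr_ge0 ?mulr_ge0// -[leRHS]sqrtr_sqr.
      apply: ler_wsqrtr; rewrite -natr1; move: b17; move: ((b N)%:R : R) => y.
      by clear; nra.
    * by move=> i j; rewrite [leRHS]splitr; exact: GE.
  + apply: cvg_EFin; first by apply: nearW.
    rewrite -[X in _ --> X]subr0; apply: cvgB; first exact: cvg_cst.
    rewrite -[X in _ --> X](mulr0 4096); apply: cvgM; first exact: cvg_cst.
    exact: cvg_harmonic.
  + exact: cvg_cst.
- (* c is the midpoint between exp (2 - gamma) and exp (-1/2); since ln N <= b,
     the bound is below c once eps N is less than half of that gap *)
  pose c := (expR (- gamma + 2) + expR (- (1 / 2%:R))) / 2 : R.
  have gap : expR (- gamma + 2) < expR (- (1 / 2%:R)) :> R by rewrite ltr_expR; lra.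
  apply: (@le_lt_trans _ _ c%:E); last first.
    by rewrite lte_fin /c; move: gap; move: (expR _) (expR _) => u v; clear; lra.
  have c0 : 0 < c - expR (- gamma + 2).
    by rewrite /c; move: gap; move: (expR _) (expR _) => u v; clear; lra.
  pose V := [set N | (0 < N)%N /\ `|eps N| < c - expR (- gamma + 2)].
  have oV : \oo V.
    rewrite /V; near=> N; split; near: N; first exact: nbhs_infty_gt.
    by move/cvgr0Pnorm_lt: eps0; apply.
  apply: (@le_trans _ _ (ereal_sup ((fun N : nat =>
      (expR (- gamma + 2%:R * ln (N%:R : R) / (b N)%:R) + eps N)%:E) @` V))).
    by apply: ereal_inf_lbound; exists V.
  apply: ge_ereal_sup => _ [N [N0 hN] <-]; rewrite lee_fin.
  rewrite -lerBrDr; apply: (@le_trans _ _ (expR (- gamma + 2))); last first.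
    by move: hN; rewrite ger0_norm// => hN; rewrite lerBrDr addrC -lerBrDr ltW.
  rewrite ler_expR lerD2l -mulrA -[leRHS]mulr1 ler_wpM2l//.
  by rewrite ler_pdivrMr ?ltr0n ?hb0// mul1r hb.
Unshelve. all: by end_near. Qed.
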